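(* Let $(\mathcal V,p,e)$ be a hyperbolic system of degree $n>1$, and let $T:\mathcal V\to\mathcal V$ be a linear transformation. Then $T$ preserves $e$-doubly stochastic $\mathcal V$-matrices (that is, $[T(a_1),T(a_2),\dots,T(a_n)]$ is $e$-doubly stochastic whenever $[a_1,a_2,\dots,a_n]$ is $e$-doubly stochastic) if and only if $T$ is operator doubly stochastic, that is, $$T(\Lambda_+)\subseteq\Lambda_+,\quad T(e)=e,\quad\text{and}\quad \operatorname{tr}(T(x))=\operatorname{tr}(x)\ \text{ for all } x\in\mathcal V.$$
   Context: A hyperbolic system $(\mathcal V,p,e)$ of degree $n$ consists of a nonzero finite-dimensional real vector space $\mathcal V$, a nonzero element $e\in\mathcal V$, and a real homogeneous polynomial $p$ of degree $n$ on $\mathcal V$ such that $p(e)\neq 0$ and, for each $x\in\mathcal V$, the univariate polynomial $t\mapsto p(te-x)$ has only real zeros. For $x\in\mathcal V$, $\lambda(x)=(\lambda_1(x),\dots,\lambda_n(x))^T\in\mathbb R^n$ is the vector of these zeros (with multiplicity) in decreasing order $\lambda_1(x)\ge\dots\ge\lambda_n(x)$. The hyperbolicity cone is $\Lambda_+=\{x\in\mathcal V:\lambda(x)\ge 0\}$ (entrywise). The trace is $\operatorname{tr}(x)=\sum_{i=1}^n\lambda_i(x)$. (No completeness of $p$ is assumed.) A $\mathcal V$-matrix is an $n$-tuple $[a_1,\dots,a_n]$ of elements of $\mathcal V$. It is $e$-doubly stochastic if $a_i\in\Lambda_+$ and $\operatorname{tr}(a_i)=1$ for all $i=1,\dots,n$,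 and $a_1+\dots+a_n=e$. *)

(* Defs.v *)
From HB Require Import structures.
From mathcomp Require Import all_boot all_order all_algebra.
From mathcomp Require Import reals.
From mathcomp Require Import polyrcf complex.
From mathcomp Require Import mpoly.

Set Implicit Arguments.
Unset Strict Implicit.
Unset Printing Implicit Defensive.

Import Order.TTheory GRing.Theory Num.Theory.
Local Open Scope ring_scope.

(* A real polynomial on V is a multivariate polynomial in the coordinates     *)
(* of x with respect to a fixed basis of V; being homogeneous of degree n     *)
(* does not depend on the choice of the basis.                                *)
Definition polyfun (R : realType) (V : vectType R) := {mpoly R[\dim {:V}]}.

Definition coords (R : realType) (V : vectType R) (x : V) :
    'I_(\dim {:V}) -> R :=
  fun i => coord (vbasis {:V}) i x.

Definition peval (R : realType) (V : vectType R) (p : polyfun V) (x : V) : R :=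
  p.@[coords x].

(* The univariate polynomial t |-> p(t e - x); see char_polyfunE. *)
Definition char_polyfun (R : realType) (V : vectType R)
    (p : polyfun V) (e x : V) : {poly R} :=
  mmap (@polyC R) (fun i => coords e i *: 'X - (coords x i)%:P) p.

Lemma char_polyfunE (R : realType) (V : vectType R) (p : polyfun V)
  (e x : V) (t : R) : (char_polyfun p e x).[t] = peval p (t *: e - x).
Proof.
rewrite /char_polyfun /peval /meval /mmap horner_sum.
apply: eq_bigr => m _; rewrite hornerM hornerC; congr (_ * _).
rewrite /mmap1 horner_prod; apply: eq_bigr => i _.
by rewrite horner_exp !hornerE /coords linearB linearZ /= mulrC.
Qed.

(* V is nonzero because e is. *)
Record hyperbolic_system (R : realType) (V : vectType R) (n : nat)
    (p : polyfun V) (e : V) : Prop := HyperbolicSystem {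
  hyp_direction_neq0 : e != 0;
  hyp_homogeneous : p \is n.-homog;
  hyp_peval_neq0 : peval p e != 0;
  hyp_real_zeros : forall (x : V) (z : R[i]),
    root (map_poly (real_complex R) (char_polyfun p e x)) z -> z \is Num.real
}.

(* The real zeros of q, repeated according to multiplicity, in decreasing     *)
(* order.                                                                     *)
Definition zeros (R : realType) (q : {poly R}) : seq R :=
  sort >=%R (flatten [seq nseq (mup r q) r | r <- rootsR q]).

Lemma zeros_prod (R : realType) (q : {poly R}) : q != 0 ->
  (forall z : R[i], root (map_poly (real_complex R) q) z -> z \is Num.real) ->
  q = lead_coef q *: \prod_(r <- zeros q) ('X - r%:P).
Proof.
move=> q0 qreal.
have [s Ds] := closed_field_poly_normal (map_poly (real_complex R) q).
have c0 : lead_coef (map_poly (real_complex R) q) != 0.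
  by rewrite lead_coef_eq0 map_poly_eq0.
have sreal z : z \in s -> z = ((complex.Re z)%:C)%C.
  move=> zs; apply/esym/RRe_real/qreal.
  by rewrite Ds rootZ // root_prod_XsubC.
pose t := [seq complex.Re z | z <- s].
have qE : q = lead_coef q *: \prod_(r <- t) ('X - r%:P).
  apply: (map_poly_inj (real_complex R)).
  rewrite [LHS]Ds map_polyZ lead_coef_map map_prod_XsubC big_map /=.
  by congr (_ *: _); apply: eq_big_seq => z /sreal {1}->.
rewrite {1}qE; congr (_ *: _); apply: perm_big; rewrite perm_sym perm_sort.
apply/allP => r _ /=; apply/eqP.
have -> : count_mem r t = mup r q.
  by rewrite qE -mul_polyC mupMr ?mu_prod_XsubC // rootC lead_coef_eq0.
rewrite count_flatten -map_comp sumnE big_map.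
under eq_bigr do rewrite /= count_nseq.
have rq : (r \in rootsR q) = root q r by rewrite -roots_on_rootsR ?in_itv.
have [rr|/mupNroot mr] := boolP (root q r).
  rewrite (bigD1_seq r) ?uniq_roots ?rq //= eqxx mul1n big1 ?addn0 // => i.
  by move/negPf => ->.
rewrite mr big1 // => i _ /=; have [->|] := eqVneq i r; last by [].
by rewrite mr muln0.
Qed.

Lemma char_polyfun_lead (R : realType) (V : vectType R) (n : nat)
    (p : polyfun V) (e x : V) : p \is n.-homog ->
  (size (char_polyfun p e x) <= n.+1)%N /\
  (char_polyfun p e x)`_n = peval p e.
Proof.
move=> ph; pose P d (q : {poly R}) c := (size q <= d.+1)%N /\ q`_d = c.
have PM d1 d2 q1 q2 c1 c2 :
    P d1 q1 c1 -> P d2 q2 c2 -> P (d1 + d2)%N (q1 * q2) (c1 * c2).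
  move=> [s1 <-] [s2 <-]; split.
    apply: leq_trans (size_polyMleq _ _) _; rewrite -subn1 leq_subLR.
    by apply: leq_trans (leq_add s1 s2) _; rewrite addnS addSn add1n.
  have lt1 : (d1 < (d1 + d2).+1)%N by rewrite ltnS leq_addr.
  rewrite coefM (bigD1 (Ordinal lt1)) //= addKn big1 ?addr0 // => i.
  rewrite -val_eqE /= => ne; have [lt|gt|/eqP] := ltngtP i d1.
  - rewrite [q2`_ _]nth_default ?mulr0 //; apply: leq_trans s2 _.
    by rewrite ltn_subRL ltn_add2r.
  - by rewrite [q1`_ _]nth_default ?mul0r //; apply: leq_trans s1 _.
  - by rewrite (negPf ne).
have P0 c : P 0%N c%:P c by split; rewrite ?size_polyC_leq1 ?coefC.
have PX d q c k : P d q c -> P (d * k)%N (q ^+ k) (c ^+ k).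
  move=> Pq; elim: k => [|k IH]; first by rewrite muln0 !expr0; exact: P0.
  by rewrite mulnS !exprS; apply: PM.
have Pm m : P (mdeg m) (mmap1 (fun i => coords e i *: 'X - (coords x i)%:P) m)
              (mmap1 (coords e) m).
  rewrite /mmap1 mdegE.
  apply: (big_ind3 (fun d q c => P d q c)); [exact: P0| |] => [|i _].
    by move=> *; apply: PM.
  rewrite -[X in P X](mul1n (m i)); apply: PX; split.
    apply: leq_trans (size_polyD _ _) _; rewrite geq_max size_polyN.
    rewrite (leq_trans (size_scale_leq _ _)) ?size_polyX //.
    by rewrite (leq_trans (size_polyC_leq1 _)).
  by rewrite coefB coefZ coefX coefC mulr1 subr0.
suff : P n (char_polyfun p e x) (peval p e) by [].
rewrite /char_polyfun /peval /meval /mmap !big_seq.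
apply: (big_ind2 (fun q c => P n q c)).
- by split; rewrite ?size_poly0 ?coef0.
- move=> q1 c1 q2 c2 [s1 <-] [s2 <-]; split; last by rewrite coefD.
  by apply: leq_trans (size_polyD _ _) _; rewrite geq_max s1.
move=> m mp; rewrite -[n]add0n; apply: PM; first exact: P0.
by rewrite -(dhomog_mf ph mp); apply: Pm.
Qed.

Lemma char_polyfun_prod (R : realType) (V : vectType R) (n : nat)
    (p : polyfun V) (e x : V) : hyperbolic_system n p e ->
  char_polyfun p e x =
  peval p e *: \prod_(r <- zeros (char_polyfun p e x)) ('X - r%:P).
Proof.
move=> [_ ph pe hz]; have [sz cn] := char_polyfun_lead e x ph.
have szE : size (char_polyfun p e x) = n.+1.
  apply/eqP; rewrite eqn_leq sz ltnNge; apply: contraNN pe => le.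
  by rewrite -cn nth_default.
have -> : peval p e = lead_coef (char_polyfun p e x).
  by rewrite lead_coefE szE.
apply: zeros_prod; last exact: hz.
by rewrite -size_poly_eq0 szE.
Qed.

Lemma size_zeros (R : realType) (V : vectType R) (n : nat)
    (p : polyfun V) (e x : V) : hyperbolic_system n p e ->
  size (zeros (char_polyfun p e x)) = n.
Proof.
move=> hs; have [_ ph pe _] := hs; have [sz cn] := char_polyfun_lead e x ph.
have szE : size (char_polyfun p e x) = n.+1.
  apply/eqP; rewrite eqn_leq sz ltnNge; apply: contraNN pe => le.
  by rewrite -cn nth_default.
have := congr1 (fun q : {poly R} => size q) (char_polyfun_prod x hs).
by rewrite szE size_scale // size_prod_XsubC => -[].
Qed.

(* By size_zeros the default value of nth is never used for a hyperbolic      *)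
(* system of degree n.                                                        *)
Definition lambda (R : realType) (V : vectType R) (n : nat)
    (p : polyfun V) (e x : V) : 'cV[R]_n :=
  \col_i nth 0 (zeros (char_polyfun p e x)) i.

Definition hyp_cone (R : realType) (V : vectType R) (n : nat)
    (p : polyfun V) (e : V) : pred V :=
  fun x => [forall i, 0 <= lambda n p e x i 0].

Definition hyp_tr (R : realType) (V : vectType R) (n : nat)
    (p : polyfun V) (e x : V) : R :=
  \sum_i lambda n p e x i 0.

Definition doubly_stochastic (R : realType) (V : vectType R) (n : nat)
    (p : polyfun V) (e : V) (a : 'I_n -> V) : Prop :=
  [/\ forall i, a i \in hyp_cone n p e,
      forall i, hyp_tr n p e (a i) = 1
    & \sum_i a i = e].

Definition operator_doubly_stochastic (R : realType) (V : vectType R) (n : nat)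
    (p : polyfun V) (e : V) (T : {linear V -> V}) : Prop :=
  [/\ forall x, x \in hyp_cone n p e -> T x \in hyp_cone n p e,
      T e = e
    & forall x, hyp_tr n p e (T x) = hyp_tr n p e x].

(* Main.v *)
Require Import Defs.
From mathcomp Require Import all_boot all_order all_algebra.
From mathcomp Require Import reals.
From mathcomp Require Import mpoly lra.

(** Homogeneity gives [lambda (s x + c e) = s lambda x + c], up to reordering,
    for [s <> 0].  Hence an element [a] of the cone with trace 1 has all its
    eigenvalues in [0, 1], so [a, (e - a)/(n-1), ..., (e - a)/(n-1)] is doubly
    stochastic.  Applied to the normalization of [x + c e] for large [c], the
    hypothesis on [T] yields [tr (T x) = tr x] for every [x]; for [x] in the
    cone every [c > 0] is allowed, so the eigenvalues of [T x] are at least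
    [- c] for every [c > 0]. *)

Set Implicit Arguments.
Unset Strict Implicit.
Unset Printing Implicit Defensive.
Local Open Scope ring_scope.

Import Order.TTheory GRing.Theory Num.Theory.

(** The difference vanishes at [0, 1, ..., size - 1], which are distinct in characteristic zero: too
    many roots for a nonzero polynomial. *)
Lemma horner_ext (R : numDomainType) (q1 q2 : {poly R}) :
  (forall t, q1.[t] = q2.[t]) -> q1 = q2.
Proof.
move=> q12; apply/eqP; rewrite -subr_eq0; apply/eqP.
pose rs : seq R := [seq k%:R | k <- iota 0 (size (q1 - q2))].
apply: (@roots_geq_poly_eq0 _ _ rs).
- by apply/allP => t _; rewrite rootE hornerD hornerN q12 subrr.
- by rewrite map_inj_uniq ?iota_uniq //; apply: mulrIn; rewrite oner_eq0.
- by rewrite size_map size_iota.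
Qed.

Lemma peval_scale (R : realType) (V : vectType R) (n : nat) (p : polyfun V)
    (s : R) (x : V) :
  p \is n.-homog -> peval p (s *: x) = s ^+ n * peval p x.
Proof.
move=> ph; rewrite /peval /meval /mmap !big_seq mulr_sumr.
apply: eq_bigr => m mp; rewrite mulrCA; congr (_ * _).
have -> : n = mdeg m by rewrite -(dhomog_mf ph mp).
rewrite mdegE /mmap1 -prodrXr -big_split /=.
by apply: eq_bigr => i _; rewrite /coords linearZ /= exprMn.
Qed.

Section Spectrum.

Variables (R : realType) (V : vectType R) (n : nat) (p : polyfun V) (e : V).
Hypothesis hsys : hyperbolic_system n p e.

Local Notation spec x := (zeros (char_polyfun p e x)).

(** Since [t e - (s x + c e) = s (((t - c) / s) e - x)], homogeneity turns one characteristic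
    polynomial into the other, and unique factorization compares the zeros. A negative [s] reverses
    their order, hence [perm_eq]. *)
Lemma perm_zeros_affine (s c : R) (x : V) : s != 0 ->
  perm_eq (spec (s *: x + c *: e)) [seq s * r + c | r <- spec x].
Proof.
move=> s0; have [_ ph pe _] := hsys.
apply: prod_XsubC_eq; apply: (scalerI pe); rewrite -(char_polyfun_prod _ hsys).
apply: horner_ext => t; rewrite char_polyfunE.
have -> : t *: e - (s *: x + c *: e) = s *: ((t - c) / s *: e - x).
  rewrite scalerBr scalerA mulrC divfK // scalerBl opprD addrAC addrA.
  by rewrite addrAC.
rewrite (peval_scale _ _ ph) -char_polyfunE {1}(char_polyfun_prod _ hsys).
rewrite !hornerZ mulrCA; congr (_ * _).
(* Reading [n] as the number of zeros gives each linear factor one [s]: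
   [s ((t - c) / s - r) = t - (s r + c)]. *)
rewrite !horner_prod big_map -[in X in s ^+ X](size_zeros x hsys).
rewrite -sum1_size -prodrXr -big_split /=; apply: eq_bigr => r _.
by rewrite !hornerXsubC expr1 mulrBr mulrC divfK // opprD addrCA addrC.
Qed.

Lemma hyp_coneP (x : V) :
  reflect (forall r, r \in spec x -> 0 <= r) (x \in hyp_cone n p e).
Proof.
apply: (iffP forallP) => [H r /(nthP 0)[i]|H i].
  by rewrite (size_zeros x hsys) => lt <-; have := H (Ordinal lt); rewrite mxE.
by rewrite mxE; apply/H/mem_nth; rewrite (size_zeros x hsys).
Qed.

Lemma hyp_trE (x : V) : hyp_tr n p e x = \sum_(r <- spec x) r.
Proof.
rewrite (big_nth 0) (size_zeros x hsys) big_mkord.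
by apply: eq_bigr => i _; rewrite mxE.
Qed.

Lemma hyp_cone_affine (s c : R) (x : V) : s != 0 ->
  (forall r, r \in spec x -> 0 <= s * r + c) <->
  s *: x + c *: e \in hyp_cone n p e.
Proof.
move=> s0; split => [H|/hyp_coneP H].
  apply/hyp_coneP => r; rewrite (perm_mem (perm_zeros_affine _ _ s0)).
  by case/mapP => r' r'x ->; apply: H.
move=> r rx; apply: H; rewrite (perm_mem (perm_zeros_affine _ _ s0)).
by apply/mapP; exists r.
Qed.

Lemma hyp_tr_affine (s c : R) (x : V) : s != 0 ->
  hyp_tr n p e (s *: x + c *: e) = s * hyp_tr n p e x + n%:R * c.
Proof.
move=> s0; rewrite !hyp_trE (perm_big _ (perm_zeros_affine _ _ s0)) big_map.
rewrite big_split /= -mulr_sumr big_const_seq count_predT (size_zeros x hsys).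
by rewrite iter_addr_0 mulr_natl.
Qed.

Lemma zeros_le_tr (x : V) (r : R) :
  x \in hyp_cone n p e -> r \in spec x -> r <= hyp_tr n p e x.
Proof.
move=> /hyp_coneP H rx; rewrite hyp_trE (big_rem r) //= lerDl big_seq.
by apply: sumr_ge0 => r' /mem_rem /H.
Qed.

Hypothesis hn : (1 < n)%N.

Lemma doubly_stochastic_extend (a : V) (i0 : 'I_n) :
    a \in hyp_cone n p e -> hyp_tr n p e a = 1 ->
  exists2 b : 'I_n -> V, doubly_stochastic p e b & b i0 = a.
Proof.
move=> ca ta; pose k : R := n.-1%:R.
have nE : n%:R = k + 1 :> R by rewrite /k natr1 prednK // ltnW.
have k0 : 0 < k by rewrite ltr0n -subn1 subn_gt0.
have kN : - k^-1 != 0 by rewrite oppr_eq0 invr_neq0 // gt_eqF.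
(* This is [(e - a) / (n - 1)] in affine form; its eigenvalues are [(1 - r) / (n - 1)], with
   [r <= tr a = 1]. *)
pose d := - k^-1 *: a + k^-1 *: e.
have cd : d \in hyp_cone n p e.
  apply/hyp_cone_affine => // r ra.
  rewrite mulNr addrC -[X in X - _]mulr1 -mulrBr pmulr_rge0 ?invr_gt0 //.
  by rewrite subr_ge0 -ta zeros_le_tr.
have td : hyp_tr n p e d = 1.
  rewrite hyp_tr_affine // ta nE mulr1 mulrDl mul1r divff ?gt_eqF //.
  by rewrite addrCA addNr addr0.
exists (fun i => if i == i0 then a else d); last by rewrite eqxx.
split=> [i|i|]; [by case: ifP|by case: ifP|].
rewrite (bigD1 i0) //= eqxx (eq_bigr (fun=> d)) => [|i /negPf -> //].
rewrite sumr_const cardC1 card_ord -scaler_nat -/k scalerDr !scalerA.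
by rewrite mulrN divff ?gt_eqF // scaleN1r scale1r addNKr.
Qed.

Variable T : {linear V -> V}.
Hypothesis hT : forall a : 'I_n -> V,
  doubly_stochastic p e a -> doubly_stochastic p e (fun i => T (a i)).

(** The hypotheses say that [x + c e] lies in the cone with positive trace [tau]. Its normalization
    [a] is an entry of a doubly stochastic tuple, whose image yields all three claims. *)
Lemma preserver_shift (x : V) (c : R) :
    (forall r, r \in spec x -> 0 <= r + c) ->
    0 < hyp_tr n p e x + n%:R * c ->
  [/\ forall r, r \in spec (T x) -> 0 <= r + c,
      T e = e & hyp_tr n p e (T x) = hyp_tr n p e x].
Proof.
move=> xc; set tau := _ + _ => tau0.
have s0 : 0 < tau^-1 by rewrite invr_gt0.
have sN : tau^-1 != 0 by rewrite gt_eqF.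
pose a := tau^-1 *: x + (tau^-1 * c) *: e.
have ca : a \in hyp_cone n p e.
  apply/hyp_cone_affine => // r rx.
  by rewrite -mulrDr mulr_ge0 ?xc // ltW.
have ta : hyp_tr n p e a = 1.
  by rewrite hyp_tr_affine // mulrCA -mulrDr mulVf // gt_eqF.
have [b bds b0] := doubly_stochastic_extend (Ordinal (ltnW hn)) ca ta.
have [cTb tTb sTb] := hT bds; have [_ _ sb] := bds.
(* Both the tuple and its image sum to [e]. *)
have Te : T e = e by rewrite -{1}sb linear_sum.
have TaE : T a = tau^-1 *: T x + (tau^-1 * c) *: e.
  by rewrite linearD !linearZ /= Te.
split=> // [r rTx|].
  have := cTb (Ordinal (ltnW hn)); rewrite b0 TaE => /(hyp_cone_affine _ _ sN).
  by move/(_ r rTx); rewrite -mulrDr pmulr_rge0.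
(* The claim becomes [tr (T a) = tr a], where both sides are 1. *)
apply/(mulfI sN)/(addIr (n%:R * (tau^-1 * c))).
by rewrite -!hyp_tr_affine // -TaE -[RHS]/(hyp_tr n p e a) ta -b0 tTb.
Qed.

Lemma exists_shift (x : V) : exists2 c : R,
  forall r, r \in spec x -> 0 <= r + c & 0 < hyp_tr n p e x + n%:R * c.
Proof.
pose S := \sum_(r <- spec x) `|r|.
have S0 : 0 <= S by apply: sumr_ge0.
have n1 : 1 <= n%:R :> R by rewrite ler1n ltnW.
(* [S] bounds every [|r|] and also [- tr x]; the extra 1 makes the shifted trace strictly
   positive. *)
exists (1 + S) => [r rx|].
  have : `|r| <= S by rewrite /S (big_rem r) //= lerDl sumr_ge0.
  by rewrite ler_norml => /andP[? _]; lra.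
have : - S <= hyp_tr n p e x.
  by rewrite hyp_trE lerNl (le_trans (ler_norm _)) // normrN ler_norm_sum.
have : 1 + S <= n%:R * (1 + S) by rewrite ler_peMl // addr_ge0.
by lra.
Qed.

Lemma preserver_operator_doubly_stochastic :
  operator_doubly_stochastic n p e T.
Proof.
split=> [x xcone||x]; last 2 first.
(* The vector 0 is an arbitrary choice, as [T e = e] does not involve [x]. *)
- by have [c c1 c2] := exists_shift 0; have [] := preserver_shift c1 c2.
- by have [c c1 c2] := exists_shift x; have [] := preserver_shift c1 c2.
have x0 := hyp_coneP _ xcone.
(* The shift [c = 0] could leave trace 0, which cannot be normalized; hence the bound [0 <= r + c]
   for all [c > 0]. *)
apply/hyp_coneP => r rTx; apply/ler_addgt0Pr => c c0.
have [||+ _ _] := @preserver_shift x c; last by apply.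
  by move=> r' /x0 r'0; apply: addr_ge0 => //; exact: ltW.
apply: ltr_wpDl; last by apply: mulr_gt0 => //; rewrite ltr0n ltnW.
by rewrite hyp_trE big_seq; apply: sumr_ge0 => r' /x0.
Qed.

End Spectrum.

Theorem theorem4p1 (R : realType) (V : vectType R) (n : nat)
    (p : polyfun V) (e : V) (T : {linear V -> V})
    (hsys : hyperbolic_system n p e) (hn : (1 < n)%N) :
  (forall a : 'I_n -> V,
      doubly_stochastic p e a -> doubly_stochastic p e (fun i => T (a i)))
  <-> operator_doubly_stochastic n p e T.
Proof.
split; first exact: preserver_operator_doubly_stochastic.
move=> [Tcone Te Ttr] a [acone atr asum]; split=> [i|i|].
- exact: Tcone.
- by rewrite Ttr.
- by rewrite -linear_sum asum.
Qed.
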